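(* Let $\mathcal{H}_1,\mathcal{H}_2$ be Hilbert spaces, let $\Psi=(\psi_k)$ be a Bessel sequence in $\mathcal{H}_1$ with bound $B$, and let $\Phi=(\phi_k)$ be a Bessel sequence in $\mathcal{H}_2$ with bound $B'$. 1. Let $M$ be a matrix in $l^{(2,2)}$. Then $\mathcal{O}^{(\Phi,\Psi)}(M)\in\mathcal{HS}(\mathcal{H}_1,\mathcal{H}_2)$, the Hilbert–Schmidt class of operators from $\mathcal{H}_1$ to $\mathcal{H}_2$, with $$\|\mathcal{O}^{(\Phi,\Psi)}(M)\|_{\mathcal{HS}}\le\sqrt{BB'}\,\|M\|_{fro}.$$ 2. Let $O\in\mathcal{HS}(\mathcal{H}_1,\mathcal{H}_2)$. Then $\mathcal{M}^{(\Phi,\Psi)}(O)\in l^{(2,2)}$ with $$\|\mathcal{M}^{(\Phi,\Psi)}(O)\|_{fro}\le\sqrt{BB'}\,\|O\|_{\mathcal{HS}}.$$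
   Context: Hilbert spaces are complex, infinite-dimensional and separable, with inner product linear in the first argument. Sequences are indexed by a countable set $K$ and $l^2=l^2(K)$. A sequence $(\psi_k)$ in $\mathcal{H}$ is a Bessel sequence with bound $B$ if $\sum_k|\langle f,\psi_k\rangle|^2\le B\|f\|^2$ for all $f\in\mathcal{H}$. A bounded operator $T:\mathcal{H}_1\to\mathcal{H}_2$ is Hilbert–Schmidt if $\|T\|_{\mathcal{HS}}:=\left(\sum_n\|Te_n\|^2\right)^{1/2}<\infty$ for some (equivalently, every) orthonormal basis $(e_n)$ of $\mathcal{H}_1$; the value does not depend on the basis. $l^{(2,2)}$ is the set of (infinite) matrices $M=(M_{i,j})_{i,j\in K}$ with finite Frobenius norm $\|M\|_{fro}=\left(\sum_i\sum_j|M_{i,j}|^2\right)^{1/2}$. $\mathcal{M}^{(\Phi,\Psi)}(O)$ is the matrix $(\mathcal{M}^{(\Phi,\Psi)}(O))_{m,n}=\langle O\psi_n,\phi_m\rangle$. $\mathcal{O}^{(\Phi,\Psi)}(M)$ is the operator $h\mapsto\sum_k\left(\sum_j M_{k,j}\langle h,\psi_j\rangle\right)\phi_k$ from $\mathcal{H}_1$ to $\mathcal{H}_2$. *)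

(* Defs.v *)
From HB Require Import structures.
From mathcomp Require Import all_boot all_order all_algebra.
From mathcomp Require Import finmap complex.
From mathcomp.analysis.showcase Require Import summability.
(* Imported after [summability] so that [summable] is the notion of esum.v. *)
From mathcomp Require Import all_classical all_reals all_analysis.

Set Implicit Arguments.
Unset Strict Implicit.
Unset Printing Implicit Defensive.

Import Order.TTheory GRing.Theory Num.Theory.
Import numFieldNormedType.Exports.

Local Open Scope classical_set_scope.
Local Open Scope complex_scope.
Local Open Scope ring_scope.

(* [{dot H for Num.conj}] is linear in its first argument and conjugate-linear
   in the second one. *)
HB.mixin Record CompleteNormedModule_isHilbert (R : realType) H
    & CompleteNormedModule R[i] H := {
  inner : {dot H for (@Num.conj R[i])} ;
  inner_norm : forall x : H, inner x x = `|x| ^+ 2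
}.

#[short(type="hilbertType")]
HB.structure Definition Hilbert (R : realType) :=
  { H of CompleteNormedModule R[i] H & CompleteNormedModule_isHilbert R H }.

Notation "'<<|' x , y '|>>'" := (inner x y)
  (at level 0, x at level 69, y at level 69) : ring_scope.

(* The norm of a normed module over [R[i]] takes its values in [R[i]]; they are
   real, and [rnorm] reads them in [R].  It applies to scalars as well. *)
Definition rnorm (R : realType) (V : normedZmodType R[i]) (x : V) : R :=
  complex.Re `|x|.

Definition span (R : realType) (V : lmodType R[i]) (A : set V) : set V :=
  [set x | exists (n : nat) (v : 'I_n -> V) (c : 'I_n -> R[i]),
     (forall i, A (v i)) /\ x = \sum_(i < n) c i *: v i].

Definition separable (T : topologicalType) : Prop :=
  exists D : set T, countable D /\ dense D.

Definition infinite_dimensional (R : realType) (V : lmodType R[i]) : Prop :=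
  forall A : set V, finite_set A -> span A <> setT.

Section Sums.
Context {R : realType} {K : countType} {V : normedModType R[i]}.

(* Unconditional summation: the limit along the finite subsets of [K]. *)
Definition has_sum (x : K -> V) : Prop :=
  cvg (summability.partial_sum x @ summability.totally).

Definition usum (x : K -> V) : V := summability.sum x.

End Sums.

Section Operators.
Context {R : realType} {H1 H2 : hilbertType R}.

(* The spaces considered are separable and infinite-dimensional, so that their
   orthonormal bases are indexed by [nat]. *)
Definition orthonormal_basis (H : hilbertType R) (e : nat -> H) : Prop :=
  (forall m n, <<| e m, e n |>> = (m == n)%:R) /\ dense (span (range e)).

Definition bounded_operator (T : H1 -> H2) : Prop :=
  linear T /\ exists c : R, forall x, rnorm (T x) <= c * rnorm x.

(* The Hilbert-Schmidt norm of [T] computed in the basis [e], possibly [+oo]. *)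
Definition hs_norm (e : nat -> H1) (T : H1 -> H2) : \bar R :=
  sqrte (\esum_(n in [set: nat]) (rnorm (T (e n)) ^+ 2)%:E).

Definition hilbert_schmidt (T : H1 -> H2) : Prop :=
  bounded_operator T /\
  exists e : nat -> H1, orthonormal_basis e /\ (hs_norm e T < +oo)%E.

End Operators.

Section Matrices.
Context {R : realType} {K : countType}.

Definition bessel (H : hilbertType R) (psi : K -> H) (B : R) : Prop :=
  forall f : H,
    (\esum_(k in [set: K]) (rnorm <<| f, psi k |>> ^+ 2)%:E
       <= (B * rnorm f ^+ 2)%:E)%E.

Definition fro_norm (M : K -> K -> R[i]) : \bar R :=
  sqrte (\esum_(i in [set: K]) \esum_(j in [set: K]) (rnorm (M i j) ^+ 2)%:E).

Definition l22 (M : K -> K -> R[i]) : Prop := (fro_norm M < +oo)%E.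

Context {H1 H2 : hilbertType R}.

Definition matrix_of_op (Phi : K -> H2) (Psi : K -> H1) (O : H1 -> H2) :
    K -> K -> R[i] :=
  fun m n => <<| O (Psi n), Phi m |>>.

(* Coordinates of the image of [h]; [R[i]^o] is [R[i]] as a normed module. *)
Definition op_coef (Psi : K -> H1) (M : K -> K -> R[i]) (h : H1) (k : K) :
    R[i]^o :=
  usum (fun j : K => M k j * <<| h, Psi j |>> : R[i]^o).

Definition op_of_matrix (Phi : K -> H2) (Psi : K -> H1) (M : K -> K -> R[i]) :
    H1 -> H2 :=
  fun h => usum (fun k : K => op_coef Psi M h k *: Phi k).

(* A limit that does not exist has an arbitrary value in the library; this says
   that all the sums in [op_of_matrix] converge. *)
Definition op_of_matrix_converges (Phi : K -> H2) (Psi : K -> H1)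
    (M : K -> K -> R[i]) : Prop :=
  forall h : H1,
    (forall k : K, has_sum (fun j : K => M k j * <<| h, Psi j |>> : R[i]^o)) /\
    has_sum (fun k : K => op_coef Psi M h k *: Phi k).

End Matrices.

(* Main.v *)
(** The series of [O(M) h] are syntheses [sum_k c_k phi_k] of square-summable
    coefficients along a Bessel sequence: they converge unconditionally and
    [|sum_k c_k phi_k|^2 <= B sum_k |c_k|^2].  Hence the k-th coefficient of
    [O(M) h] is [<h, g_k>] with [g_k = sum_j conj(M_kj) psi_j] and
    [|g_k|^2 <= B sum_j |M_kj|^2].  For an orthonormal basis [e], Bessel's
    inequality gives
    [sum_n |O(M) e_n|^2 <= B' sum_n sum_k |<e_n, g_k>|^2 <= B' sum_k |g_k|^2].

    Conversely [<O ., phi_m>] is represented by a vector [u_m] with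
    [|u_m|^2 <= sum_k |<O e_k, phi_m>|^2], so
    [sum_m sum_n |<psi_n, u_m>|^2 <= B sum_k sum_m |<O e_k, phi_m>|^2
     <= B B' sum_k |O e_k|^2].  Both directions hold for each orthonormal basis
    separately, so the basis independence of the Hilbert-Schmidt norm plays no
    role; a basis of [H1] comes from the Gram-Schmidt process. *)

Require Import Defs.
From HB Require Import structures.
From mathcomp Require Import all_boot all_order all_algebra.
From mathcomp Require Import finmap complex.
From mathcomp.analysis.showcase Require Import summability.
From mathcomp Require Import all_classical all_reals all_analysis.
From mathcomp Require Import ring.

Set Implicit Arguments.
Unset Strict Implicit.
Unset Printing Implicit Defensive.

Import Order.TTheory GRing.Theory Num.Theory.
Import numFieldNormedType.Exports.

Local Open Scope classical_set_scope.
Local Open Scope complex_scope.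
Local Open Scope ring_scope.

#[local] Existing Instance totally_filter.

(** * Real-valued norms and the finite Cauchy-Schwarz inequality *)

Section RealNorm.
Context {R : realType}.

Lemma rnormE (V : normedZmodType R[i]) (x : V) : `|x| = (rnorm x)%:C.
Proof. by rewrite /rnorm RRe_real// normr_real. Qed.

Lemma rnorm_ge0 (V : normedZmodType R[i]) (x : V) : 0 <= rnorm x.
Proof. by rewrite -ler0c -rnormE. Qed.

Lemma rnorm0 (V : normedZmodType R[i]) : rnorm (0 : V) = 0.
Proof. by apply: complexI; rewrite -rnormE normr0. Qed.

Lemma rnorm0_eq0 (V : normedZmodType R[i]) (x : V) : rnorm x = 0 -> x = 0.
Proof. by move=> x0; apply: normr0_eq0; rewrite rnormE x0. Qed.

Lemma rnormN (V : normedZmodType R[i]) (x : V) : rnorm (- x) = rnorm x.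
Proof. by rewrite /rnorm normrN. Qed.

Lemma ler_rnormD (V : normedZmodType R[i]) (x y : V) :
  rnorm (x + y) <= rnorm x + rnorm y.
Proof. by rewrite -lecR rmorphD/= -!rnormE ler_normD. Qed.

Lemma rnormZ (V : normedModType R[i]) (a : R[i]) (x : V) :
  rnorm (a *: x) = rnorm a * rnorm x.
Proof. by apply: complexI; rewrite rmorphM/= -!rnormE normrZ. Qed.

Lemma rnormM (a b : R[i]) : rnorm (a * b) = rnorm a * rnorm b.
Proof. by apply: complexI; rewrite rmorphM/= -!rnormE normrM. Qed.

Lemma rnormC (a : R) : 0 <= a -> rnorm a%:C = a.
Proof. by move=> a0; apply: complexI; rewrite -rnormE ger0_norm// ler0c. Qed.

Lemma rnorm_conj (a : R[i]) : rnorm a^* = rnorm a.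
Proof. by rewrite /rnorm norm_conjC. Qed.

Lemma mul_conj_rnorm (a : R[i]) : a * a^* = (rnorm a ^+ 2)%:C.
Proof. by rewrite -normCK rnormE rmorphXn. Qed.

Lemma ler_rnorm_sum (V : normedZmodType R[i]) (I : Type) (r : seq I)
    (F : I -> V) :
  rnorm (\sum_(i <- r) F i) <= \sum_(i <- r) rnorm (F i).
Proof.
elim/big_ind2: _ => [|x a y b xa yb|//]; first by rewrite rnorm0.
exact: le_trans (ler_rnormD _ _) (lerD xa yb).
Qed.

Lemma cauchy_schwarz_sum (I : Type) (r : seq I) (a b : I -> R) :
  (\sum_(i <- r) a i * b i) ^+ 2 <=
  (\sum_(i <- r) a i ^+ 2) * (\sum_(i <- r) b i ^+ 2).
Proof.
(* Lagrange's identity *)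
have h : 0 <= \sum_(i <- r) \sum_(j <- r) (a i * b j - a j * b i) ^+ 2.
  by apply: sumr_ge0 => i _; apply: sumr_ge0 => j _; exact: sqr_ge0.
have E : \sum_(i <- r) \sum_(j <- r) (a i * b j - a j * b i) ^+ 2 =
    ((\sum_(i <- r) a i ^+ 2) * (\sum_(i <- r) b i ^+ 2)) *+ 2 -
    (\sum_(i <- r) a i * b i) ^+ 2 *+ 2.
  rewrite [in RHS]mulr2n {2}[_ * (\sum_(i <- r) b i ^+ 2)]mulrC expr2.
  rewrite !big_distrlr/= -sumrMnl -big_split -sumrB/=.
  apply: eq_bigr => i _; rewrite -sumrMnl -big_split -sumrB/=.
  by apply: eq_bigr => j _; rewrite mulr2n; ring.
by move: h; rewrite E -mulrnBl pmulrn_lge0// subr_ge0.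
Qed.

End RealNorm.

(** * Algebra of the inner product and its Cauchy-Schwarz inequality *)

Section Inner.
Context {R : realType} {H : hilbertType R}.
Implicit Types x y z : H.

Lemma inner_conj x y : <<| x, y |>> = (<<| y, x |>>)^*.
Proof. by rewrite (hermC (@inner R H) x y)/= expr0 mul1r. Qed.

Lemma innerDl x y z : <<| x + y, z |>> = <<| x, z |>> + <<| y, z |>>.
Proof. exact: linearDl. Qed.

Lemma inner0l x : <<| 0, x |>> = 0.
Proof. exact: linear0l. Qed.

Lemma inner0r x : <<| x, 0 |>> = 0.
Proof. exact: linear0r. Qed.

Lemma innerBl x y z : <<| x - y, z |>> = <<| x, z |>> - <<| y, z |>>.
Proof. exact: linearBl. Qed.

Lemma innerZl a x y : <<| a *: x, y |>> = a * <<| x, y |>>.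
Proof. exact: linearZl_LR. Qed.

Lemma innerBr x y z : <<| x, y - z |>> = <<| x, y |>> - <<| x, z |>>.
Proof. exact: linearBr. Qed.

Lemma innerZr a x y : <<| x, a *: y |>> = a^* * <<| x, y |>>.
Proof. exact: linearZr_LR. Qed.

Lemma inner_suml (I : Type) (r : seq I) (F : I -> H) y :
  <<| \sum_(i <- r) F i, y |>> = \sum_(i <- r) <<| F i, y |>>.
Proof. exact: linear_sumlz. Qed.

Lemma inner_sumr (I : Type) (r : seq I) (F : I -> H) x :
  <<| x, \sum_(i <- r) F i |>> = \sum_(i <- r) <<| x, F i |>>.
Proof. exact: linear_sumr. Qed.

Lemma inner_self x : <<| x, x |>> = (rnorm x ^+ 2)%:C.
Proof. by rewrite inner_norm rnormE rmorphXn. Qed.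

Lemma rnorm_innerC x y : rnorm <<| x, y |>> = rnorm <<| y, x |>>.
Proof. by rewrite inner_conj rnorm_conj. Qed.

Lemma cauchy_schwarz x y : rnorm <<| x, y |>> <= rnorm x * rnorm y.
Proof.
have [y0|y0] := eqVneq (rnorm y) 0.
  by rewrite y0 mulr0 (rnorm0_eq0 y0) inner0r rnorm0.
have yp : 0 < rnorm y by rewrite lt_def y0 rnorm_ge0.
set p := <<| x, y |>>.
(* [|y|^2] times the component of [x] orthogonal to [y] *)
pose u := <<| y, y |>> *: x - p *: y.
have E : <<| u, u |>> =
    (rnorm y ^+ 2 * ((rnorm x * rnorm y) ^+ 2 - rnorm p ^+ 2))%:C.
  have -> : (rnorm y ^+ 2 * ((rnorm x * rnorm y) ^+ 2 - rnorm p ^+ 2))%:C =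
      <<| y, y |>> * (<<| x, x |>> * <<| y, y |>> - p * p^*) :> R[i].
    by rewrite !inner_self mul_conj_rnorm exprMn !(rmorphB, rmorphM).
  rewrite /u innerBl !innerBr !innerZl !innerZr -/p (inner_conj y x) -/p.
  by rewrite -(inner_conj y y); ring.
have : 0 <= rnorm y ^+ 2 * ((rnorm x * rnorm y) ^+ 2 - rnorm p ^+ 2).
  by rewrite -ler0c -E inner_norm exprn_ge0.
rewrite pmulr_rge0 ?exprn_gt0// subr_ge0 ler_pXn2r// nnegrE ?rnorm_ge0//.
by rewrite mulr_ge0 ?rnorm_ge0.
Qed.

End Inner.

(** * Sums over finite subsets, and limits measured by [rnorm] *)

Section Sums.
Context {R : realType}.

Lemma esum_fset_le (K : choiceType) (a : K -> R) (C : R) :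
  (forall J : {fset K}, \sum_(i <- J) a i <= C) ->
  (\esum_(i in [set: K]) (a i)%:E <= C%:E)%E.
Proof.
move=> aC; apply: ge_ereal_sup => _ [X [finX _] <-].
by rewrite fsbig_finite// sumEFin lee_fin.
Qed.

Lemma fset_le_esum (K : choiceType) (a : K -> R) (J : {fset K}) :
  ((\sum_(i <- J) a i)%:E <= \esum_(i in [set: K]) (a i)%:E)%E.
Proof.
apply: esum_ge; exists [set` J]; first by split.
by rewrite fsbig_finite//= set_fsetK sumEFin.
Qed.

Lemma partial_sumE (K : choiceType) (V : zmodType) (x : K -> V) (J : {fset K}) :
  partial_sum x J = \sum_(i <- J) x i.
Proof. by rewrite [RHS]big_seq_fsetE. Qed.

Lemma cvg_rnormP (V : normedModType R[i]) (T : Type) (F : set_system T)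
    (FF : Filter F) (f : T -> V) (y : V) :
  f @ F --> y <->
  forall eps : R, 0 < eps -> \forall t \near F, rnorm (y - f t) < eps.
Proof.
split=> [/cvgrPdist_lt + e e0|fy]; last first.
  (* A positive element of [R[i]] has zero imaginary part, so real radii suffice. *)
  apply/cvgrPdist_lt => -[e e']; rewrite ltcE/= => /andP[/eqP-> e0].
  near=> t; rewrite rnormE ltcR; near: t; exact: fy.
move=> /(_ e%:C); rewrite ltcR => /(_ e0); apply: filterS => t.
by rewrite rnormE ltcR.
Unshelve. all: by end_near. Qed.

Lemma rnorm_lim_le (V : normedModType R[i]) (T : Type) (F : set_system T)
    (FF : ProperFilter F) (f : T -> V) (y : V) (c : R) :
  f @ F --> y -> (forall t, rnorm (f t) <= c) -> rnorm y <= c.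
Proof.
move=> /cvg_rnormP fy fc; apply/ler_addgt0Pr => e e0.
have [t /ltW yt] := filter_ex (fy _ e0).
rewrite -(subrK (f t) y) addrC; apply: le_trans (ler_rnormD _ _) _.
exact: lerD.
Qed.

Lemma cvg_inner (H : hilbertType R) (T : Type) (F : set_system T)
    (FF : Filter F) (f : T -> H) (x y : H) :
  f @ F --> y ->
  (<<| x, f t |>> : R[i]^o) @[t --> F] --> (<<| x, y |>> : R[i]^o).
Proof.
move=> /cvg_rnormP fy; apply/cvg_rnormP => e e0.
have x1 : 0 < rnorm x + 1 by rewrite ltr_wpDl ?rnorm_ge0.
have := fy _ (divr_gt0 e0 x1); apply: filterS => t.
rewrite ltr_pdivlMr// => yt; apply: le_lt_trans yt.
rewrite -[X in rnorm X](innerBr x y (f t)).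
apply: le_trans (cauchy_schwarz _ _) _.
by rewrite mulrC ler_wpM2l ?rnorm_ge0// lerDl.
Qed.

Lemma cvg_usum (K : countType) (V : normedModType R[i]) (x : K -> V) (s : V) :
  partial_sum x @ totally --> s -> usum x = s.
Proof.
exact: (cvg_lim (@norm_hausdorff _ V)).
Qed.

Lemma has_sum_cvg (K : countType) (V : normedModType R[i]) (x : K -> V) :
  has_sum x -> partial_sum x @ totally --> usum x.
Proof. by []. Qed.

End Sums.

(** * Synthesis of square-summable coefficients along a Bessel sequence *)

Section Synthesis.
Context {R : realType} {H : hilbertType R} {K : countType}.
Variables (phi : K -> H) (B : R).
Hypotheses (B0 : 0 <= B) (bphi : bessel phi B).

Lemma bessel_fset (f : H) (J : {fset K}) :
  \sum_(k <- J) rnorm <<| f, phi k |>> ^+ 2 <= B * rnorm f ^+ 2.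
Proof. by rewrite -lee_fin; apply: le_trans (fset_le_esum _ _) (bphi f). Qed.

(** Duality: with [f] the finite sum, expanding the first [f] in [<<| f, f |>>] and applying
    Cauchy-Schwarz bounds |f|^4 by sum |c_k|^2 times sum |<f, phi_k>|^2. The Bessel condition bounds
    the last sum by B |f|^2, and |f|^2 cancels. *)
Lemma synthesis_fset (c : K -> R[i]) (J : {fset K}) :
  rnorm (\sum_(k <- J) c k *: phi k) ^+ 2 <= B * \sum_(k <- J) rnorm (c k) ^+ 2.
Proof.
set f := \sum_(k <- J) _; set S := \sum_(k <- J) _.
have S0 : 0 <= S by apply: sumr_ge0 => k _; exact: sqr_ge0.
have [->|f0] := eqVneq (rnorm f ^+ 2) 0; first exact: mulr_ge0.
have fp : 0 < rnorm f ^+ 2 by rewrite lt_def f0 sqr_ge0.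
rewrite -(ler_pM2r fp) -expr2 [leRHS]mulrAC.
rewrite -{1}(rnormC (sqr_ge0 (rnorm f))) -inner_self.
apply: (@le_trans _ _
  ((\sum_(k <- J) rnorm (c k) * rnorm <<| f, phi k |>>) ^+ 2)).
  rewrite ler_pXn2r ?nnegrE ?rnorm_ge0 ?sumr_ge0// => [|k _]; last first.
    by rewrite mulr_ge0 ?rnorm_ge0.
  rewrite {1}/f inner_suml; apply: le_trans (ler_rnorm_sum _ _) _.
  by apply: ler_sum => k _; rewrite innerZl rnormM (rnorm_innerC f).
apply: le_trans (cauchy_schwarz_sum _ _ _) _.
by rewrite mulrC; apply: ler_wpM2r => //; exact: bessel_fset.
Qed.

(** Cauchy's criterion: a finite set [A] exhausts the sum of squares up to [d], so for every finite
    [J] containing [A] the finite bound controls the part outside [A]. *)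
Lemma has_sum_synthesis (c : K -> R[i]) :
  (\esum_(k in [set: K]) (rnorm (c k) ^+ 2)%:E < +oo)%E ->
  has_sum (fun k => c k *: phi k).
Proof.
move=> cfin; apply: cauchy_cvg; apply: cauchy_exP => -[e e'].
rewrite ltcE/= => /andP[/eqP-> e0].
set E := (\esum_(k in _) _)%E in cfin.
have Efin : E \is a fin_num.
  by rewrite ge0_fin_numE//; apply: esum_ge0 => k _; rewrite lee_fin sqr_ge0.
(* Chosen so that [B * d < e ^+ 2]; the added 1 covers [B = 0]. *)
pose d := e ^+ 2 / (B + 1).
have B1 : 0 < B + 1 by rewrite ltr_wpDl.
have d0 : 0 < d by rewrite divr_gt0// exprn_gt0.
have : (E - d%:E < E)%E by rewrite lteBlDr// lteDl// lte_fin.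
move=> /ereal_sup_gt[_ [X [finX _] <-]].
rewrite fsbig_finite// sumEFin; set A := fset_set X => EA.
exists (partial_sum (fun k => c k *: phi k) A).
exists A => // J /= AJ; rewrite -ball_normE/= rnormE ltcR !partial_sumE.
(* Generic in [V]: applied to the vectors and to the squared moduli. *)
have JA (V : zmodType) (G : K -> V) : \sum_(k <- J) G k =
    \sum_(k <- A) G k + \sum_(k <- (J `\` A)%fset) G k.
  rewrite (big_fsetID _ (mem A))/=; congr (_ + _); apply: eq_fbigl => k.
    by rewrite !inE/= andbC; apply: andb_idr => /(fsubsetP AJ).
  by rewrite !inE/= andbC.
rewrite JA opprD addrA subrr sub0r rnormN.
rewrite -(@ltr_pXn2r _ 2%N)// ?nnegrE ?rnorm_ge0 ?ltW//.
apply: le_lt_trans (synthesis_fset _ _) _.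
have SJ : \sum_(k <- (J `\` A)%fset) rnorm (c k) ^+ 2 < d.
  rewrite -(ltrD2l (\sum_(k <- A) rnorm (c k) ^+ 2)) -JA -lte_fin.
  apply: le_lt_trans (fset_le_esum _ _) _.
  by rewrite EFinD -lteBlDr.
apply: (@le_lt_trans _ _ (B * d)); first by rewrite ler_wpM2l// ltW.
by rewrite /d mulrA ltr_pdivrMr// mulrC ltr_pM2l ?exprn_gt0// ltrDl.
Qed.

Lemma usum_synthesis_le (c : K -> R[i]) (S : R) :
  (\esum_(k in [set: K]) (rnorm (c k) ^+ 2)%:E <= S%:E)%E ->
  rnorm (usum (fun k => c k *: phi k)) ^+ 2 <= B * S.
Proof.
move=> cS.
have S0 : 0 <= S.
  rewrite -lee_fin; apply: le_trans cS.
  by apply: esum_ge0 => k _; rewrite lee_fin sqr_ge0.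
have BS0 : 0 <= B * S by exact: mulr_ge0.
have /has_sum_cvg h := has_sum_synthesis (le_lt_trans cS (ltry _)).
rewrite -(sqr_sqrtr BS0) ler_pXn2r ?nnegrE ?rnorm_ge0 ?sqrtr_ge0//.
apply: rnorm_lim_le h _ => J; rewrite partial_sumE.
rewrite -(@ler_pXn2r _ 2%N)// ?nnegrE ?rnorm_ge0 ?sqrtr_ge0// sqr_sqrtr//.
apply: le_trans (synthesis_fset _ _) _; rewrite ler_wpM2l//.
by rewrite -lee_fin; apply: le_trans (fset_le_esum _ _) cS.
Qed.

(** Continuity of the inner product transports convergence to scalars; the conjugates come from
    conjugate-linearity in the second argument. *)
Lemma cvg_inner_synthesis (c : K -> R[i]) (h : H) :
  (\esum_(k in [set: K]) (rnorm (c k) ^+ 2)%:E < +oo)%E ->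
  partial_sum (fun k => (c k)^* * <<| h, phi k |>> : R[i]^o) @ totally -->
  (<<| h, usum (fun k => c k *: phi k) |>> : R[i]^o).
Proof.
move=> /has_sum_synthesis/has_sum_cvg cphi.
have -> : partial_sum (fun k => (c k)^* * <<| h, phi k |>> : R[i]^o) =
    (fun J => <<| h, partial_sum (fun k => c k *: phi k) J |>>).
  apply/funext => J; rewrite !partial_sumE inner_sumr.
  by apply: eq_bigr => k _; rewrite innerZr.
exact: cvg_inner cphi.
Qed.

End Synthesis.

(** * Bessel's inequality and existence of orthonormal bases *)

Section OrthonormalBasis.
Context {R : realType} {H : hilbertType R}.

Lemma dense_rnorm (A : set H) (x : H) (eps : R) :
  dense A -> 0 < eps -> exists2 a, A a & rnorm (x - a) < eps.
Proof.
move=> dA e0; have e0' : 0 < eps%:C by rewrite ltcR.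
have [] := dA (interior (ball x eps%:C)).
- by exists x; exact: nbhsx_ballx.
- exact: open_interior.
- move=> a [/interior_subset + Aa]; rewrite -ball_normE/= rnormE ltcR => xa.
  by exists a.
Qed.

(** Such an [f] is Lipschitz. This serves both the Gram-Schmidt residuals and the Riesz
    representation. *)
Lemma dense_bounded_eq0 (V : normedModType R[i]) (f : H -> V) (C : R)
    (A : set H) :
  {morph f : x y / x - y} -> (forall x, rnorm (f x) <= C * rnorm x) ->
  dense A -> (forall a, A a -> f a = 0) -> forall x, f x = 0.
Proof.
move=> fB fC dA fA x; apply: rnorm0_eq0.
apply/eqP; rewrite eq_le rnorm_ge0 andbT.
apply/ler_addgt0Pr => e e0; rewrite add0r.
have C1 : 0 < `|C| + 1 by rewrite ltr_wpDl.
have [a Aa xa] := dense_rnorm x dA (divr_gt0 e0 C1).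
rewrite -[f x]subr0 -(fA a Aa) -fB; apply: le_trans (fC _) _.
move: xa; rewrite ltr_pdivlMr// => /ltW; apply: le_trans.
rewrite mulrC ler_wpM2l ?rnorm_ge0// (le_trans (ler_norm C))// lerDl.
exact: ler01.
Qed.

(** The partial expansion [v] of [f] satisfies <f, v> = |v|^2 = S, so Cauchy-Schwarz gives S^2 <=
    |f|^2 S. *)
Lemma orthonormal_bessel (e : nat -> H) :
  (forall m n, <<| e m, e n |>> = (m == n)%:R) -> bessel e 1.
Proof.
move=> oe f; apply: esum_fset_le => J; rewrite mul1r.
set S := \sum_(k <- J) _; pose v := \sum_(k <- J) <<| f, e k |>> *: e k.
have S0 : 0 <= S by apply: sumr_ge0 => k _; exact: sqr_ge0.
have [->|SN0] := eqVneq S 0; first exact: sqr_ge0.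
have CS : \sum_(k <- J) <<| f, e k |>>^* * <<| f, e k |>> = S%:C.
  rewrite /S rmorph_sum; apply: eq_bigr => k _.
  by rewrite mulrC mul_conj_rnorm.
have fv : <<| f, v |>> = S%:C.
  by rewrite /v inner_sumr -CS; apply: eq_bigr => k _; rewrite innerZr.
have vv : rnorm v ^+ 2 = S.
  apply: complexI; rewrite -inner_self {1}/v inner_suml -CS.
  rewrite big_seq [RHS]big_seq; apply: eq_bigr => k kJ.
  rewrite innerZl /v inner_sumr (big_rem k)//= innerZr oe eqxx mulr1.
  rewrite big_seq big1 ?addr0 1?mulrC// => i.
  rewrite mem_rem_uniq ?fset_uniq// inE => /andP[ik _].
  by rewrite innerZr oe eq_sym (negbTE ik) mulr0.
have Sp : 0 < S by rewrite lt_def SN0.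
have := cauchy_schwarz f v; rewrite fv rnormC//.
rewrite -(@ler_pXn2r _ 2%N)//; last first.
- by rewrite nnegrE mulr_ge0 ?rnorm_ge0.
- by rewrite exprMn vv expr2 ler_pM2r.
Qed.

(** For orthonormal [l] this is the component orthogonal to the span; for any [l], [resid l x = 0]
    puts [x] in the span of [l]. *)
Let resid (l : seq H) (x : H) := x - \sum_(v <- l) <<| x, v |>> *: v.

Let residB l : {morph resid l : x y / x - y}.
Proof.
move=> x y; rewrite /resid.
under eq_bigr => v _ do rewrite innerBl scalerBl.
by rewrite sumrB !opprD addrACA.
Qed.

Let resid_bounded l x :
  rnorm (resid l x) <= (1 + \sum_(v <- l) rnorm v ^+ 2) * rnorm x.
Proof.
apply: le_trans (ler_rnormD _ _) _; rewrite rnormN mulrDl mul1r lerD2l.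
apply: le_trans (ler_rnorm_sum _ _) _; rewrite mulr_suml.
apply: ler_sum => v _; rewrite rnormZ expr2 -mulrA mulrC.
by rewrite ler_wpM2l ?rnorm_ge0// mulrC cauchy_schwarz.
Qed.

(** * The Gram-Schmidt process *)

Section GramSchmidt.
Variable d : nat -> H.
Hypothesis d_resid : forall l, exists n, resid l (d n) != 0.

(* The first [d k] outside the span of [l] is orthonormalized, so that after [n]
   steps [d 0], ..., [d n.-1] are in the span. *)
Let next l : H :=
  let r := resid l (d (ex_minn (d_resid l))) in (rnorm r)^-1%:C *: r.

Let gs n : seq H := iter n (fun l => rcons l (next l)) [::].

Let e n : H := next (gs n).

Let rs n x := x - \sum_(i < n) <<| x, e i |>> *: e i.

Let rsE n x : resid (gs n) x = rs n x.
Proof.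
rewrite /rs /resid; congr (_ - _).
elim: n => [|n ih]; first by rewrite big_nil big_ord0.
by rewrite big_ord_recr/= -ih -cats1 big_cat big_seq1.
Qed.

Let eE n : exists2 k, rs n (d k) != 0 &
  (forall i, rs n (d i) != 0 -> (k <= i)%N) /\
  e n = (rnorm (rs n (d k)))^-1%:C *: rs n (d k).
Proof.
rewrite /e /next; case: ex_minnP => k; rewrite !rsE => k0 kmin.
by exists k => //; split=> // i; rewrite -rsE; exact: kmin.
Qed.

(** Induction on the common bound [n]: orthonormality of the first [n] vectors makes every [rs n x]
    orthogonal to them, and [e n] is a normalized residual. *)
Let orth n : forall i j, (i < n)%N -> (j < n)%N ->
  <<| e i, e j |>> = (i == j)%:R.
Proof.
elim: n => [//|n ih].
have orthr x j : (j < n)%N -> <<| rs n x, e j |>> = 0.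
  move=> jn; rewrite innerBl inner_suml (bigD1 (Ordinal jn))//= innerZl ih//.
  rewrite eqxx mulr1 big1 ?addr0 ?subrr// => i ij.
  by rewrite innerZl ih// (_ : (_ == _) = false) ?mulr0//; exact: negbTE.
have [k k0 [_ en]] := eE n.
have enj j : (j < n)%N -> <<| e n, e j |>> = 0.
  by move=> jn; rewrite en innerZl orthr// mulr0.
have enn : <<| e n, e n |>> = 1.
  rewrite inner_self en rnormZ rnormC ?invr_ge0 ?rnorm_ge0//.
  rewrite mulVf ?expr1n//; apply: contra_neq k0; exact: rnorm0_eq0.
move=> i j; rewrite ltnS leq_eqVlt => /predU1P[->|iN].
  rewrite ltnS leq_eqVlt => /predU1P[->|jN]; first by rewrite eqxx.
  by rewrite enj// gtn_eqF.
rewrite ltnS leq_eqVlt => /predU1P[->|jN]; last exact: ih.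
by rewrite inner_conj enj// conjC0 ltn_eqF.
Qed.

(** Since [e n] is orthogonal to the earlier vectors, [x] and [rs n x] have the same coefficient
    along it. *)
Let rsS n x : rs n.+1 x = rs n x - <<| rs n x, e n |>> *: e n.
Proof.
rewrite {1}/rs big_ord_recr/= opprD addrA -/(rs n x); congr (_ - _ *: _).
rewrite innerBl inner_suml big1 ?subr0// => i _.
by rewrite innerZl (@orth n.+1 i n (ltnW (ltn_ord i)) (ltnSn n)) ltn_eqF ?mulr0.
Qed.

(** If [d i] still has a nonzero residual at step [n], minimality gives k <= i, while the induction
    hypothesis gives n <= k. Hence i = k, and subtracting the component along [e n] removes the
    residual. *)
Let rs_d n i : (i < n)%N -> rs n (d i) = 0.
Proof.
elim: n i => [//|n ih] i; rewrite ltnS => iN; rewrite rsS.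
have [->|i0] := eqVneq (rs n (d i)) 0.
  by rewrite inner0l scale0r subrr.
have [k k0 [kmin en]] := eE n.
have -> : i = k.
  apply/eqP; rewrite eqn_leq kmin// andbT (leq_trans iN)// leqNgt.
  by apply: contraNN k0 => /ih ->.
set r := rs n (d k) in en k0 *.
have r0 : (rnorm r)%:C != 0 :> R[i].
  by rewrite -rnormE normr_eq0.
apply/eqP; rewrite subr_eq0 en innerZr inner_self scalerA.
have -> : ((rnorm r)^-1%:C)^* = (rnorm r)^-1%:C :> R[i] by exact: conjc_real.
by rewrite rmorphXn/= fmorphV/= expr2 mulKf// mulfV// scale1r.
Qed.

Lemma gram_schmidt : exists2 f : nat -> H,
  (forall m n, <<| f m, f n |>> = (m == n)%:R) &
  (forall n, Defs.span (range f) (d n)).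
Proof.
exists e => [m n|n].
  by apply: (@orth (maxn m n).+1); rewrite ltnS ?leq_maxl ?leq_maxr.
exists n.+1, (fun i => e i), (fun i => <<| d n, e i |>>); split.
  by move=> i; exists (val i).
by apply/eqP; rewrite -subr_eq0; apply/eqP; exact: rs_d.
Qed.

End GramSchmidt.

(** Gram-Schmidt on a dense sequence never stops: if [resid l] vanished on the whole sequence, it
    would vanish everywhere by density, and the finite list [l] would span [H]. *)
Lemma exists_orthonormal_basis : separable H -> infinite_dimensional H ->
  exists e : nat -> H, orthonormal_basis e.
Proof.
move=> [D [/countable_injP[f finj] dD]] infH.
(* Indices outside the image of [D] under [f] get the default 0; only [d (f x) = x] on [D]
   matters. *)
pose d n : H := xget 0 [set x | D x /\ f x = n].
have dE x : D x -> d (f x) = x.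
  move=> Dx; rewrite /d; case: xgetP => [y -> [Dy fyx]|/(_ x)]; last by case.
  by apply: finj; rewrite ?inE.
have d_resid l : exists n, resid l (d n) != 0.
  apply: contrapT => /forallNP dl; apply: (infH [set` l] (finite_seq l)).
  apply/seteqP; split=> // x _.
  have : resid l x = 0.
    apply: (dense_bounded_eq0 (@residB l) (resid_bounded l) dD) => a Da.
    by have /negP := dl (f a); rewrite negbK dE// => /eqP.
  move=> /eqP; rewrite subr_eq0 => /eqP xE.
  exists (size l), (fun i => l`_i), (fun i => <<| x, l`_i |>>); split.
    by move=> i; exact: mem_nth.
  by rewrite {1}xE (big_nth 0) big_mkord.
have [e oe spe] := gram_schmidt d_resid.
exists e; split=> // U U0 Uo; have [x [Ux Dx]] := dD U U0 Uo.
by exists x; split=> //; rewrite -(dE x Dx).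
Qed.

End OrthonormalBasis.

(** * Scaling, exchange and square roots of nonnegative sums *)

Section EsumBounds.
Context {R : realType}.

Lemma esum_sqr_ge0 (K : choiceType) (a : K -> R) :
  (0 <= \esum_(k in [set: K]) (a k ^+ 2)%:E)%E.
Proof. by apply: esum_ge0 => k _; rewrite lee_fin sqr_ge0. Qed.

Lemma esum_scale_le (K : choiceType) (a : K -> R) (c S : R) : 0 <= c ->
  (\esum_(k in [set: K]) (a k)%:E <= S%:E)%E ->
  (\esum_(k in [set: K]) (c * a k)%:E <= (c * S)%:E)%E.
Proof.
move=> c0 aS; apply: esum_fset_le => J; rewrite -mulr_sumr ler_wpM2l//.
by rewrite -lee_fin; apply: le_trans (fset_le_esum _ _) aS.
Qed.

(** One-sided Tonelli: each finite part of the outer sum moves inside, so bounds on finite column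
    sums suffice. *)
Lemma esum_esum_le (I K : choiceType) (a : I -> K -> R) (b : K -> R) (S : R) :
  (forall i k, 0 <= a i k) ->
  (forall (J : {fset I}) k, \sum_(i <- J) a i k <= b k) ->
  (\esum_(k in [set: K]) (b k)%:E <= S%:E)%E ->
  (\esum_(i in [set: I]) \esum_(k in [set: K]) (a i k)%:E <= S%:E)%E.
Proof.
move=> a0 ab bS; apply: ge_ereal_sup => _ [X [finX _] <-].
rewrite fsbig_finite//= -esum_sum// => [|i k _ _]; last by rewrite lee_fin.
by apply: le_trans bS; apply: le_esum => k _; rewrite sumEFin lee_fin.
Qed.

Lemma esum_le_term (K : choiceType) (a : K -> \bar R) (k : K) :
  (forall i, 0 <= a i)%E -> (a k <= \esum_(i in [set: K]) a i)%E.
Proof.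
move=> a0; apply: esum_ge; exists [set k]; first by split.
by rewrite fsbig_set1.
Qed.

Lemma sqrte_lty (x : \bar R) : (0 <= x -> sqrte x < +oo -> x < +oo)%E.
Proof. by case: x => //= x _ _; exact: ltry. Qed.

Lemma sqrte_le_scale (c : R) (x y : \bar R) : 0 <= c -> (0 <= y)%E ->
  (x <= c%:E * y)%E -> (sqrte x <= (Num.sqrt c)%:E * sqrte y)%E.
Proof.
move=> c0 y0 xy.
rewrite -[(Num.sqrt c)%:E]/(sqrte c%:E) -sqrteM ?lee_fin//.
by rewrite lee_sqrt// mule_ge0// lee_fin.
Qed.

End EsumBounds.

(** A nonzero vector forces the sign; in the zero space a negative [B] would pass. The space is
    nonzero because the empty set does not span it. *)
Lemma bessel_bound_ge0 (R : realType) (H : hilbertType R) (K : countType)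
    (psi : K -> H) (B : R) :
  infinite_dimensional H -> bessel psi B -> 0 <= B.
Proof.
move=> infH bpsi; have [x x0] : exists x : H, rnorm x != 0.
  apply: contrapT => /forallNP x0; apply: (infH set0 (finite_set0 _)).
  apply/seteqP; split=> // x _; have /negP := x0 x.
  rewrite negbK => /eqP/rnorm0_eq0->; exists 0%N, (fun=> 0), (fun=> 0).
  by split=> [[]//|]; rewrite big_ord0.
have := le_trans (esum_sqr_ge0 _) (bpsi x).
by rewrite lee_fin pmulr_lge0// lt_def sqrf_eq0 x0 sqr_ge0.
Qed.

(** * From Frobenius matrices to Hilbert-Schmidt operators *)

Section OperatorOfMatrix.
Context {R : realType} {H1 H2 : hilbertType R} {K : countType}.
Variables (Psi : K -> H1) (Phi : K -> H2) (B B' : R).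
Hypotheses (B0 : 0 <= B) (B'0 : 0 <= B').
Hypotheses (bPsi : bessel Psi B) (bPhi : bessel Phi B').
Variables (M : K -> K -> R[i]) (S : R).
Hypothesis MS : (\esum_(i in [set: K]) \esum_(j in [set: K])
  (rnorm (M i j) ^+ 2)%:E <= S%:E)%E.

(** Stated with conjugates because these are the coefficients of [g k] along [Psi]. *)
Let row_lty k : (\esum_(j in [set: K]) (rnorm (M k j)^* ^+ 2)%:E < +oo)%E.
Proof.
under eq_esum do rewrite rnorm_conj.
apply: le_lt_trans (le_trans (esum_le_term k _) MS) (ltry _) => i.
exact: esum_sqr_ge0.
Qed.

(* Writing the scalar series as inner products with a convergent vector series
   gives their convergence from the completeness of [H1]. *)
Let g k : H1 := usum (fun j => (M k j)^* *: Psi j).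

Let coef_cvg h k : partial_sum (fun j => M k j * <<| h, Psi j |>> : R[i]^o) @
  totally --> (<<| h, g k |>> : R[i]^o).
Proof.
have := cvg_inner_synthesis B0 bPsi (h := h) (row_lty k).
by under [X in partial_sum X]eq_fun do rewrite conjCK.
Qed.

Let op_coefE h k : op_coef Psi M h k = <<| h, g k |>>.
Proof. exact: cvg_usum (@coef_cvg h k). Qed.

Let op_of_matrixE h :
  op_of_matrix Phi Psi M h = usum (fun k => <<| h, g k |>> *: Phi k).
Proof.
by rewrite /op_of_matrix; congr usum; apply/funext => k; rewrite op_coefE.
Qed.

Let g_le : (\esum_(k in [set: K]) (rnorm (g k) ^+ 2)%:E <= (B * S)%:E)%E.
Proof.
(* Finite row sums are read in [R], as the synthesis bound takes a real number. *)
pose N k := fine (\esum_(j in [set: K]) (rnorm (M k j) ^+ 2)%:E).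
have NE k : (N k)%:E = (\esum_(j in [set: K]) (rnorm (M k j) ^+ 2)%:E)%E.
  rewrite fineK// ge0_fin_numE ?esum_sqr_ge0//; have := row_lty k.
  by under eq_esum do rewrite rnorm_conj.
apply: le_trans (_ : _ <= \esum_(k in [set: K]) (B * N k)%:E)%E _.
  apply: le_esum => k _; rewrite lee_fin; apply: usum_synthesis_le => //.
  by under eq_esum do rewrite rnorm_conj; rewrite NE.
by apply: esum_scale_le => //; under eq_esum do rewrite NE.
Qed.

Let coef_le h :
  (\esum_(k in [set: K]) (rnorm <<| h, g k |>> ^+ 2)%:E <=
    (rnorm h ^+ 2 * (B * S))%:E)%E.
Proof.
apply: le_trans (esum_scale_le (sqr_ge0 (rnorm h)) g_le).
apply: le_esum => k _; rewrite lee_fin -exprMn.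
by rewrite ler_pXn2r ?nnegrE ?mulr_ge0 ?rnorm_ge0// cauchy_schwarz.
Qed.

Let op_has_sum h : has_sum (fun k => <<| h, g k |>> *: Phi k).
Proof.
exact: (has_sum_synthesis B'0 bPhi (le_lt_trans (coef_le h) (ltry _))).
Qed.

Lemma op_of_matrix_convergesP : op_of_matrix_converges Phi Psi M.
Proof.
move=> h; split=> [k|]; first by apply: cvgP (@coef_cvg h k).
under [X in has_sum X]eq_fun do rewrite op_coefE.
exact: op_has_sum.
Qed.

Lemma op_of_matrix_linear : linear (op_of_matrix Phi Psi M).
Proof.
move=> a u v; rewrite !op_of_matrixE; apply: cvg_usum.
have -> : partial_sum (fun k => <<| a *: u + v, g k |>> *: Phi k) =
    (fun J => a *: partial_sum (fun k => <<| u, g k |>> *: Phi k) J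
              + partial_sum (fun k => <<| v, g k |>> *: Phi k) J).
  apply/funext => J; rewrite !partial_sumE scaler_sumr -big_split/=.
  by apply: eq_bigr => k _; rewrite innerDl innerZl scalerDl scalerA.
by apply: cvgD; [apply: cvgZr|]; exact: has_sum_cvg.
Qed.

Lemma op_of_matrix_bounded : bounded_operator (op_of_matrix Phi Psi M).
Proof.
split; first exact: op_of_matrix_linear.
have S0 : 0 <= S.
  rewrite -lee_fin; apply: le_trans MS.
  by apply: esum_ge0 => i _; exact: esum_sqr_ge0.
have c0 : 0 <= B' * (B * S) by rewrite !mulr_ge0.
exists (Num.sqrt (B' * (B * S))) => h.
rewrite -(@ler_pXn2r _ 2%N)// ?nnegrE ?mulr_ge0 ?rnorm_ge0 ?sqrtr_ge0//.
rewrite exprMn sqr_sqrtr// op_of_matrixE -mulrA [_ * rnorm h ^+ 2]mulrC.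
exact: usum_synthesis_le.
Qed.

Lemma op_of_matrix_hs_le (e : nat -> H1) :
  (forall m n, <<| e m, e n |>> = (m == n)%:R) ->
  (\esum_(n in [set: nat]) (rnorm (op_of_matrix Phi Psi M (e n)) ^+ 2)%:E <=
    (B * B' * S)%:E)%E.
Proof.
move=> oe.
pose N n := fine (\esum_(k in [set: K]) (rnorm <<| e n, g k |>> ^+ 2)%:E).
have NE n :
    (N n)%:E = (\esum_(k in [set: K]) (rnorm <<| e n, g k |>> ^+ 2)%:E)%E.
  rewrite fineK// ge0_fin_numE ?esum_sqr_ge0//.
  exact: le_lt_trans (coef_le _) (ltry _).
rewrite [B * B']mulrC -mulrA.
apply: le_trans (_ : _ <= \esum_(n in [set: nat]) (B' * N n)%:E)%E _.
  apply: le_esum => n _; rewrite lee_fin op_of_matrixE.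
  by apply: usum_synthesis_le => //; rewrite NE.
apply: esum_scale_le => //; under eq_esum do rewrite NE.
(* After the exchange of sums, Bessel's inequality for [e] applies to [g k] at fixed [k]. *)
apply: esum_esum_le g_le => [n k|J k]; first exact: sqr_ge0.
have := bessel_fset (orthonormal_bessel oe) (g k) J.
by rewrite mul1r; under eq_bigr do rewrite rnorm_innerC.
Qed.

End OperatorOfMatrix.

(** * From Hilbert-Schmidt operators to Frobenius matrices *)

Section MatrixOfOperator.
Context {R : realType} {H1 H2 : hilbertType R} {K : countType}.
Variables (Psi : K -> H1) (Phi : K -> H2) (B B' : R).
Hypotheses (B0 : 0 <= B) (B'0 : 0 <= B').
Hypotheses (bPsi : bessel Psi B) (bPhi : bessel Phi B').

(** The representative is sum_k conj(L e_k) e_k: it agrees with [L] on the basis, then on its span,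
    then everywhere by density. The synthesis bound with constant 1 gives its norm. *)
Lemma riesz_orthonormal (L : H1 -> R[i]^o) (C S : R) (e : nat -> H1) :
  linear L -> (forall x, rnorm (L x) <= C * rnorm x) -> orthonormal_basis e ->
  (\esum_(k in [set: nat]) (rnorm (L (e k)) ^+ 2)%:E <= S%:E)%E ->
  exists2 g : H1, (forall x, L x = <<| x, g |>>) & rnorm g ^+ 2 <= S.
Proof.
move=> linL LC [oe de] LS; have be := orthonormal_bessel oe.
have LB : {morph L : x y / x - y}.
  by move=> x y; rewrite -[- y]scaleN1r addrC linL addrC scaleN1r.
have cS : (\esum_(k in [set: nat]) (rnorm (L (e k))^* ^+ 2)%:E <= S%:E)%E.
  by under eq_esum do rewrite rnorm_conj.
exists (usum (fun k => (L (e k))^* *: e k)); last first.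
  by rewrite -[leRHS]mul1r; exact: usum_synthesis_le.
set g := usum _ => x; apply/eqP; rewrite -subr_eq0; apply/eqP.
have Le n : L (e n) = <<| e n, g |>>.
  have := cvg_inner_synthesis ler01 be (h := e n) (le_lt_trans cS (ltry _)).
  move=> /(cvg_lim (@norm_hausdorff _ _)) <-; apply/esym.
  apply: (cvg_lim (@norm_hausdorff _ _)); apply: cvg_near_cst.
  (* The partial sums are constant, equal to [L (e n)], as soon as [J] contains [n]. *)
  exists [fset n]%fset => // J /=; rewrite fsub1set => nJ.
  rewrite partial_sumE (big_rem n)//= conjCK oe eqxx mulr1.
  rewrite big_seq big1 ?addr0// => i.
  rewrite mem_rem_uniq ?fset_uniq// inE => /andP[iN _].
  by rewrite oe eq_sym (negbTE iN) mulr0.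
apply: (@dense_bounded_eq0 _ _ R[i]^o (fun x => L x - <<| x, g |>>)
  (C + rnorm g) _ _ _ de) => {x} [x y|x|x [n [v [c [ev ->]]]]].
- by rewrite LB innerBl !opprD addrACA.
- apply: le_trans (ler_rnormD _ _) _; rewrite rnormN mulrDl lerD//.
  by rewrite mulrC cauchy_schwarz.
- pose LL : {linear H1 -> R[i]^o} :=
    HB.pack L (GRing.isLinear.Build _ _ _ _ L linL).
  rewrite -[L]/(LL : H1 -> R[i]^o) linear_sum inner_suml -sumrB big1// => i _.
  by rewrite linearZ innerZl/=; have [k _ <-] := ev i; rewrite Le subrr.
Qed.

Lemma matrix_of_op_le (O : H1 -> H2) (e : nat -> H1) (S : R) :
  bounded_operator O -> orthonormal_basis e ->
  (\esum_(k in [set: nat]) (rnorm (O (e k)) ^+ 2)%:E <= S%:E)%E ->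
  (\esum_(m in [set: K]) \esum_(n in [set: K])
    (rnorm (matrix_of_op Phi Psi O m n) ^+ 2)%:E <= (B * B' * S)%:E)%E.
Proof.
move=> [linO [C OC]] oe OS; have BOS := esum_scale_le B'0 OS.
pose X m := (\esum_(k in [set: nat]) (rnorm <<| O (e k), Phi m |>> ^+ 2)%:E)%E.
(* Exchange of sums, with the Bessel bound of [Phi] at each [O (e k)]. *)
have XS : (\esum_(m in [set: K]) X m <= (B' * S)%:E)%E.
  apply: esum_esum_le BOS => [m k|J k]; first exact: sqr_ge0.
  exact: bessel_fset.
have X0 m : (0 <= X m)%E by exact: esum_sqr_ge0.
have XE m : (fine (X m))%:E = X m.
  rewrite fineK// ge0_fin_numE//.
  exact: le_lt_trans (le_trans (esum_le_term m X0) XS) (ltry _).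
rewrite -mulrA.
apply: le_trans (_ : _ <= \esum_(m in [set: K]) (B * fine (X m))%:E)%E _.
  apply: le_esum => m _.
  have [||||g Lg gX] := @riesz_orthonormal (fun x => <<| O x, Phi m |>>)
      (C * rnorm (Phi m)) (fine (X m)) e.
  - by move=> a x y; rewrite linO innerDl innerZl.
  - move=> x; apply: le_trans (cauchy_schwarz _ _) _.
    by rewrite mulrAC ler_wpM2r ?rnorm_ge0.
  - exact: oe.
  - by rewrite XE.
  - apply: le_trans (_ : _ <= (B * rnorm g ^+ 2)%:E)%E _; last first.
      by rewrite lee_fin ler_wpM2l.
    (* Row [m] consists of the numbers <psi_n, g>, so the Bessel bound of [Psi] at [g] controls
       it. *)
    apply: le_trans (bPsi g); apply: le_esum => n _.
    by rewrite /matrix_of_op Lg rnorm_innerC.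
by apply: esum_scale_le => //; under eq_esum do rewrite XE.
Qed.

End MatrixOfOperator.

(** * Passage from squared sums to norms, in every orthonormal basis *)

Theorem proposition3p6 (R : realType) (H1 H2 : hilbertType R)
    (sepH1 : separable H1) (infH1 : infinite_dimensional H1)
    (sepH2 : separable H2) (infH2 : infinite_dimensional H2)
    (K : countType) (Psi : K -> H1) (Phi : K -> H2) (B B' : R)
    (bessel_Psi : bessel Psi B) (bessel_Phi : bessel Phi B') :
  (forall M : K -> K -> R[i], l22 M ->
     [/\ op_of_matrix_converges Phi Psi M,
         hilbert_schmidt (op_of_matrix Phi Psi M) &
         forall e : nat -> H1, orthonormal_basis e ->
           (hs_norm e (op_of_matrix Phi Psi M)
              <= (Num.sqrt (B * B'))%:E * fro_norm M)%E]) /\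
  (forall O : H1 -> H2, hilbert_schmidt O ->
     l22 (matrix_of_op Phi Psi O) /\
     forall e : nat -> H1, orthonormal_basis e ->
       (fro_norm (matrix_of_op Phi Psi O)
          <= (Num.sqrt (B * B'))%:E * hs_norm e O)%E).
Proof.
have B0 := bessel_bound_ge0 infH1 bessel_Psi.
have B'0 := bessel_bound_ge0 infH2 bessel_Phi.
have BB0 : 0 <= B * B' by exact: mulr_ge0.
split=> [M M22|O [Obd [e [oe eO]]]].
  set X := (\esum_(i in [set: K]) \esum_(j in [set: K])
    (rnorm (M i j) ^+ 2)%:E)%E.
  have X0 : (0 <= X)%E by apply: esum_ge0 => i _; exact: esum_sqr_ge0.
  have Xfin : (fine X)%:E = X by rewrite fineK// ge0_fin_numE// sqrte_lty.
  have MX : (X <= (fine X)%:E)%E by rewrite Xfin.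
  have hsT e : orthonormal_basis e ->
      (hs_norm e (op_of_matrix Phi Psi M)
        <= (Num.sqrt (B * B'))%:E * fro_norm M)%E.
    move=> [oe _]; apply: sqrte_le_scale => //; rewrite -/X -Xfin -EFinM.
    exact: (op_of_matrix_hs_le B0 B'0 bessel_Psi bessel_Phi MX).
  have [e oe] := exists_orthonormal_basis sepH1 infH1.
  split=> //.
    exact: (op_of_matrix_convergesP B0 B'0 bessel_Psi bessel_Phi MX).
  split; first exact: (op_of_matrix_bounded B0 B'0 bessel_Psi bessel_Phi MX).
  exists e; split=> //; apply: le_lt_trans (hsT e oe) _.
  by rewrite lte_mul_pinfty// lee_fin sqrtr_ge0.
have fro_le e' : orthonormal_basis e' -> (hs_norm e' O < +oo)%E ->
    (fro_norm (matrix_of_op Phi Psi O)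
      <= (Num.sqrt (B * B'))%:E * hs_norm e' O)%E.
  move=> oe' /(sqrte_lty (esum_sqr_ge0 _)) Xoo.
  apply: sqrte_le_scale => //; first exact: esum_sqr_ge0.
  have Xfin := fineK (etrans (ge0_fin_numE (esum_sqr_ge0 _)) Xoo).
  rewrite -Xfin -EFinM; apply: (matrix_of_op_le B0 B'0) oe' _ => //.
  by rewrite Xfin.
split=> [|e' oe'].
  apply: le_lt_trans (fro_le e oe eO) _.
  by rewrite lte_mul_pinfty// lee_fin sqrtr_ge0.
(* An infinite norm in [e'] makes the bound trivial unless the constant is 0. Then 0 times [+oo] is
   0, and the bound in the basis [e] with finite norm already gives a Frobenius norm at most 0. *)
have [/fro_le->//|] := ltP (hs_norm e' O) +oo%E.
rewrite leye_eq => /eqP ->; have [BB|BB] := eqVneq (Num.sqrt (B * B')) 0.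
  by have := fro_le e oe eO; rewrite BB !mul0e.
by rewrite gt0_muley ?leey// lte_fin lt_def BB sqrtr_ge0.
Qed.
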